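(* The following two equalities of classes of languages hold: (1) $\text{A-P-sel} = \text{CA-P-sel}$, i.e., a set $B\subseteq\Sigma^*$ has an associative $\mathrm{FP}_t$-selector function if and only if it has an $\mathrm{FP}_t$-selector function that is both commutative and associative. (2) $\text{A-NP-sel} = \text{CA-NP-sel}$, i.e., a set $B\subseteq\Sigma^*$ has an associative $\mathrm{NPSV}_t$-selector function if and only if it has an $\mathrm{NPSV}_t$-selector function that is both commutative and associative.
   Context: $\Sigma=\{0,1\}$. All functions considered here are total, single-valued and 2-ary, $f:\Sigma^*\times\Sigma^*\to\Sigma^*$. $\mathrm{FP}_t$ is the class of such functions computable in deterministic polynomial time. $\mathrm{NPSV}_t$ is the class of such functions $f$ for which there is a nondeterministic polynomial-time Turing machine $M$ such that for all $x,y$ the set of strings output on accepting paths of $M(x,y)$ is exactly $\{f(x,y)\}$. For a class $\mathcal F$ of such functions, $f\in\mathcal F$ is an $\mathcal F$-selector function for a set $B\subseteq\Sigma^*$ if for all $x,y$: $f(x,y)\in\{x,y\}$, and if $x\in B$ or $y\in B$ then $f(x,y)\in B$. $f$ is associative if $f(a,f(b,c))=f(f(a,b),c)$ for all $a,b,c\in\Sigma^*$, and commutative if $f(a,b)=f(b,a)$ for all $a,b\in\Sigma^*$. A-P-sel (respectively A-NP-sel) is the class of sets having an associative $\mathrm{FP}_t$-selector (respectively $\mathrm{NPSV}_t$-selector) function; CA-P-sel (respectively CA-NP-sel) is the class of sets having a commutative and associative $\mathrm{FP}_t$-selector (respectively $\mathrm{NPSV}_t$-selector) function. *)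

(* Defs.v *)
From HB Require Import structures.
From mathcomp Require Import all_boot all_order all_algebra.
From mathcomp Require Import boolp classical_sets.

Set Implicit Arguments.
Unset Strict Implicit.
Unset Printing Implicit Defensive.

Local Open Scope classical_set_scope.
Local Open Scope ring_scope.

Definition word := seq bool.

Inductive move := MoveL | MoveN | MoveR.

Definition offset (m : move) : int :=
  match m with MoveL => -1 | MoveN => 0 | MoveR => 1 end.

Definition move_code (m : move) : option bool :=
  match m with MoveL => Some false | MoveN => None | MoveR => Some true end.
Definition move_decode (o : option bool) : move :=
  match o with Some false => MoveL | None => MoveN | Some true => MoveR end.
Lemma move_codeK : cancel move_code move_decode. Proof. by case. Qed.
HB.instance Definition _ := Finite.copy move (can_type move_codeK).

(* Tape symbols over an auxiliary alphabet [G]: [None] is the blank,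
   [Some (inl b)] the input letter [b], [Some (inr g)] a work letter. *)
Definition symbol (G : finType) : Type := option (bool + G).

(* [(q, w, e)]: enter state [q]; on every tape [i] write [(w i).1] in the
   scanned cell and then move the head by [(w i).2]; if [e = Some b], append
   the letter [b] to the write-only output tape. *)
Definition action (Q G : finType) (k : nat) : finType :=
  (Q * {ffun 'I_k -> option (bool + G) * move} * option bool)%type.

(* A nondeterministic multitape Turing transducer with two input tapes (number
   0 and 1), [work_tapes] further tapes, all of them two-way infinite and
   readable and writable, and a one-way write-only output tape. *)
Record transducer := Transducer {
  work_tapes : nat;
  aux : finType;
  state : finType;
  start : state;
  accept : pred state;
  delta : state -> {ffun 'I_work_tapes.+2 -> symbol aux} ->
          {set action state aux work_tapes.+2}
}.

Section Semantics.
Variable M : transducer.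

Record config := Config {
  cstate : state M;
  heads : 'I_(work_tapes M).+2 -> int;
  cells : 'I_(work_tapes M).+2 -> int -> symbol (aux M);
  output : word
}.

Definition word_tape (x : word) (z : int) : symbol (aux M) :=
  if z is Posz n then omap inl (onth x n) else None.

Definition init (x y : word) : config :=
  Config (start M) (fun=> 0)
    (fun i => match val i with
              | 0%N => word_tape x
              | 1%N => word_tape y
              | _ => fun=> None
              end)
    [::].

Definition moves (c : config) : {set action (state M) (aux M) (work_tapes M).+2} :=
  delta (cstate c) [ffun i => cells c i (heads c i)].

Definition act (a : action (state M) (aux M) (work_tapes M).+2) (c : config) :
    config :=
  let: (q, w, e) := a in
  Config q
    (fun i => heads c i + offset (w i).2)
    (fun i z => if z == heads c i then (w i).1 else cells c i z)
    (if e is Some b then rcons (output c) b else output c).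

Fixpoint run (n : nat) (c d : config) : Prop :=
  if n is n'.+1 then exists2 a, a \in moves c & run n' (act a c) d else c = d.

(* A computation path ends when no move is available; it is accepting if its
   last state is. *)
Definition accepting (c : config) : Prop := moves c = finset.set0 /\ accept (cstate c).

Definition outputs (x y : word) : set word :=
  [set w | exists n c, [/\ run n (init x y) c, accepting c & output c = w]].

Definition polytime : Prop :=
  exists p : {poly nat}, forall x y n c,
    run n (init x y) c -> (n <= p.[size x + size y])%N.

Definition deterministic : Prop := forall q s, (#|@delta M q s| <= 1)%N.

End Semantics.

(* Deterministic machines are the special case of at most one move, so that the
   unique computation path has to accept with output [f x y]. *)
Definition FPt : set (word -> word -> word) :=
  [set f | exists M, [/\ deterministic M, polytime M &
                         forall x y, outputs M x y = [set f x y]]].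

Definition NPSVt : set (word -> word -> word) :=
  [set f | exists M, polytime M /\ forall x y, outputs M x y = [set f x y]].

Definition selector (F : set (word -> word -> word)) (B : set word)
    (f : word -> word -> word) : Prop :=
  F f /\ forall x y, (f x y = x \/ f x y = y) /\ (B x \/ B y -> B (f x y)).

Definition A_sel (F : set (word -> word -> word)) : set (set word) :=
  [set B | exists2 f, selector F B f & associative f].

Definition CA_sel (F : set (word -> word -> word)) : set (set word) :=
  [set B | exists2 f, selector F B f & commutative f /\ associative f].

Definition A_P_sel := A_sel FPt.
Definition CA_P_sel := CA_sel FPt.
Definition A_NP_sel := A_sel NPSVt.
Definition CA_NP_sel := CA_sel NPSVt.

(* Main.v *)
(** A semigroup operation [f] with [f x y] always in [{x, y}] is, for some total
    preorder, the maximum of two elements of distinct classes, and on each class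
    one of the two projections.  Hence [f (min x y) (max x y)], where [min] and
    [max] refer to any total order on the carrier, is the maximum for a total
    order refining that preorder, so it is commutative and associative; only the
    transitivity of its comparison relation has to be checked.  For the
    lexicographic order on words a machine can compare its inputs in linear
    time by scanning them in parallel, and then simulate the machine for [f]
    with the two input tapes exchanged if necessary. *)
Require Import Defs.
From mathcomp Require Import all_boot all_order all_algebra.
From mathcomp Require Import perm.
From mathcomp Require Import boolp classical_sets.

Set Implicit Arguments.
Unset Strict Implicit.
Unset Printing Implicit Defensive.

Import Order.Theory GRing.Theory.

Local Open Scope ring_scope.

(** * Sorting the arguments of an associative selecting operation *)

Section SortedOperation.
Context {d : Order.disp_t} {T : orderType d}.
Variable f : T -> T -> T.

Definition sorted_op (x y : T) : T := f (Order.min x y) (Order.max x y).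

Lemma sorted_opC : commutative sorted_op.
Proof. by move=> x y; rewrite /sorted_op minC maxC. Qed.

Hypothesis fA : associative f.
Hypothesis f_sel : forall x y, f x y = x \/ f x y = y.

Lemma sorted_op_sel x y : sorted_op x y = x \/ sorted_op x y = y.
Proof.
rewrite /sorted_op minEle maxEle; case: ifP => _; first exact: f_sel.
by case: (f_sel y x) => ->; [right|left].
Qed.

Lemma sorted_op_le x y : (x <= y)%O -> sorted_op x y = f x y.
Proof. by rewrite /sorted_op minEle maxEle => ->. Qed.

(** Bracket the [f]-product of the three elements, taken in increasing order, in both ways. If
    [y <= z], the product of [x], [y], [z] is [x] one way and [z] the other; if [z <= y], the
    product of [x], [z], [y] is [x] and [y]. *)
Lemma sorted_op_cycle_min x y z : (x <= y)%O -> (x <= z)%O ->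
  sorted_op x y = y -> sorted_op y z = z -> sorted_op z x = x -> x = y \/ x = z.
Proof.
move=> xy xz; rewrite (sorted_opC z) (sorted_op_le xy) (sorted_op_le xz).
move=> fxy gyz fxz.
have [yz|/ltW zy] := leP y z.
  by right; move: gyz; rewrite sorted_op_le // => fyz; rewrite -fxz -fyz fA fxy.
move: gyz; rewrite sorted_opC sorted_op_le // => fzy; left.
by rewrite -fxy -{2}fxz -fA fzy.
Qed.

Lemma sorted_op_cycle x y z :
  sorted_op x y = y -> sorted_op y z = z -> sorted_op z x = x -> x = z.
Proof.
move=> xy yz zx.
suff [e|[e|//]]: x = y \/ y = z \/ x = z.
- by rewrite -zx sorted_opC e yz.
- by rewrite -zx -e sorted_opC xy.
(* The hypotheses are invariant under rotation of the cycle, so each case rotates a least element to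
   the front. *)
have [lxy|/ltW lyx] := leP x y; have [lyz|/ltW lzy] := leP y z;
  have [lxz|/ltW lzx] := leP x z.
- by have [] := sorted_op_cycle_min lxy lxz xy yz zx; auto.
- by have [] := sorted_op_cycle_min lxy (le_trans lxy lyz) xy yz zx; auto.
- by have [] := sorted_op_cycle_min lxy lxz xy yz zx; auto.
- by have [] := sorted_op_cycle_min lzx lzy zx xy yz; auto.
- by have [] := sorted_op_cycle_min lyz lyx yz zx xy; auto.
- by have [] := sorted_op_cycle_min lyz lyx yz zx xy; auto.
- by have [] := sorted_op_cycle_min (le_trans lzy lyx) lzy zx xy yz; auto.
- by have [] := sorted_op_cycle_min lzx lzy zx xy yz; auto.
Qed.

(** Otherwise [x], [y], [z] would form a cycle, which forces [x = z]. *)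
Lemma sorted_op_trans x y z :
  sorted_op x y = y -> sorted_op y z = z -> sorted_op x z = z.
Proof.
move=> xy yz; have [xz|//] := sorted_op_sel x z.
by rewrite xz; apply: (sorted_op_cycle xy yz); rewrite sorted_opC.
Qed.

Lemma sorted_opA : associative sorted_op.
Proof.
move=> x y z; have [xy|xy] := sorted_op_sel x y;
  have [yz|yz] := sorted_op_sel y z; rewrite xy yz ?xy //.
  (* The descending chain is an ascending one read backwards. *)
  by rewrite sorted_opC; apply/esym/(@sorted_op_trans z y x); rewrite sorted_opC.
exact: sorted_op_trans xy yz.
Qed.

End SortedOperation.

(** * Deterministic stretches of nondeterministic runs *)

Section ForcedRuns.
Variable M : transducer.

Lemma runS n (c e : config M) :
  run n.+1 c e = exists2 a, a \in moves c & run n (act a c) e.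
Proof. by []. Qed.

Inductive forced : nat -> config M -> config M -> Prop :=
| forced0 c : forced 0 c c
| forcedS n a c c' :
    moves c = finset.set1 a -> forced n (act a c) c' -> forced n.+1 c c'.

Lemma forced_run n c c' m e : forced n c c' -> run m c' e -> run (n + m) c e.
Proof.
elim=> [//|{}n a {}c {}c' mc _ IH] /IH r.
by exists a; rewrite // mc finset.set11.
Qed.

(** The first alternative is there because [polytime] bounds unfinished runs too; its nonempty set
    of moves rules out acceptance. *)
Lemma run_forced n c c' e : forced n c c' -> forall m, run m c e ->
  ((m < n)%N /\ moves e <> finset.set0) \/ (exists2 k, m = (n + k)%N & run k c' e).
Proof.
elim=> [{}c|{}n a {}c {}c' mc _ IH] m; first by right; exists m.
case: m => [/= <-|m /= [b]].
  left; split=> //; rewrite mc => /setP /(_ a).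
  by rewrite finset.set11 finset.in_set0.
rewrite mc => /finset.set1P -> /IH [[lt_mn me]|[k -> r]]; first by left.
by right; exists k.
Qed.

End ForcedRuns.

(** * The transducer that sorts its inputs *)

Definition lexmin (x y : word) : word := Order.min (x : seqlexi bool) y.
Definition lexmax (x y : word) : word := Order.max (x : seqlexi bool) y.

Definition lex_sorted (f : word -> word -> word) : word -> word -> word :=
  @sorted_op _ (seqlexi bool) f.

Section SortedTransducer.
Variable M : transducer.

Local Notation k := (work_tapes M).
Local Notation G := (aux M).

Definition tape0 : 'I_k.+2 := ord0.
Definition tape1 : 'I_k.+2 := lift ord0 ord0.

(** The inputs are exchanged by relabelling the tapes in the transition function, without copying
    any word. *)
Definition swap_tapes (b : bool) (i : 'I_k.+2) : 'I_k.+2 :=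
  if b then tperm tape0 tape1 i else i.

Lemma swap_tapesK b : involutive (swap_tapes b).
Proof. by case: b => i //=; rewrite tpermK. Qed.

Definition sorted_state : finType := (option bool + bool * state M)%type.

(* The inputs agree to the left of the heads. *)
Definition scanning : sorted_state := inl None.
(* [b] tells whether the inputs have to be exchanged. *)
Definition returning (b : bool) : sorted_state := inl (Some b).
Definition simulating (b : bool) (q : state M) : sorted_state := inr (b, q).

(* [None] if the scan goes on, otherwise whether the inputs have to be
   exchanged; on the input tapes a blank marks the end of the word. *)
Definition verdict (s t : symbol G) : option bool :=
  match s, t with
  | Some (inl a), Some (inl b) => if a == b then None else Some (a && ~~ b)
  | None, _ => Some false
  | _, _ => Some true
  end.

(** The work heads move along with the input heads, so that during the preparation a single integer
    gives the position of all heads. *)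
Definition keep_move (q : sorted_state) (s : {ffun 'I_k.+2 -> symbol G})
    (m : move) : action sorted_state G k.+2 :=
  (q, [ffun i => (s i, m)], None).

Definition swap_action (b : bool) (a : action (state M) G k.+2) :
    action sorted_state G k.+2 :=
  (simulating b a.1.1, [ffun i => a.1.2 (swap_tapes b i)], a.2).

Definition sorted_delta (q : sorted_state) (s : {ffun 'I_k.+2 -> symbol G}) :
    {set action sorted_state G k.+2} :=
  match q with
  | inl None => finset.set1
      (if verdict (s tape0) (s tape1) is Some b
       then keep_move (returning b) s MoveL else keep_move scanning s MoveR)
  | inl (Some b) => finset.set1
      (if s tape0 is Some _ then keep_move (returning b) s MoveL
       else keep_move (simulating b (start M)) s MoveR)
  | inr (b, q) =>
      imset (swap_action b) (mem (delta q [ffun i => s (swap_tapes b i)]))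
  end.

Definition sorted_transducer : transducer :=
  @Transducer k G sorted_state scanning
    (fun q => if q is inr (_, q) then accept q else false) sorted_delta.

Local Notation M' := sorted_transducer.

Lemma sorted_deterministic : deterministic M -> deterministic M'.
Proof.
move=> detM [[b|]|[b q]] s /=; rewrite ?cards1 //.
exact: leq_trans (leq_imset_card _ _) (detM _ _).
Qed.

Definition swap_config (b : bool) (c : config M) : config M' :=
  @Config M' (simulating b (cstate c)) (heads c \o swap_tapes b)
    (cells c \o swap_tapes b) (output c).

Lemma moves_swap b c :
  moves (swap_config b c) = imset (swap_action b) (mem (moves c)).
Proof.
rewrite /moves /=; congr (imset _ (mem (delta _ _))).
by apply/ffunP => i; rewrite !ffunE /= swap_tapesK.
Qed.

Lemma act_swap b a c :
  act (swap_action b a : action (state M') (aux M') (work_tapes M').+2)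
    (swap_config b c) = swap_config b (act a c).
Proof.
case: a => [[q w] e]; rewrite /swap_config /=; congr Config.
  by apply: funext => i; rewrite ffunE.
by apply: funext => i; apply: funext => z; rewrite ffunE.
Qed.

Lemma run_swap b n c e : run n (swap_config b c) e <->
  exists2 c', run n c c' & e = swap_config b c'.
Proof.
elim: n c => [|n IH] c.
  by split=> [/= <-|[c' /= -> ->]] //; exists c.
rewrite runS; split=> [[a]|[c' [a mca r] e_eq]].
  rewrite moves_swap => /imsetP [a' mca' ->]; rewrite act_swap => /IH [c' r ->].
  by exists c' => //; exists a'.
exists (swap_action b a); first by rewrite moves_swap; apply: imset_f.
by rewrite act_swap; apply/IH; exists c'.
Qed.

Lemma accepting_swap b c : accepting (swap_config b c) <-> accepting c.
Proof.
rewrite /accepting moves_swap /=; split=> -[mc ac]; split=> //.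
  by apply/eqP; rewrite -(imset_eq0 (swap_action b)); apply/eqP.
by apply/eqP; rewrite imset_eq0; apply/eqP.
Qed.

(** * Comparing the inputs and returning to the origin *)

Section Preparation.
Variables x y : word.

Definition parallel (q : sorted_state) (z : int) : config M' :=
  @Config M' q (fun=> z) (cells (init M' x y)) [::].

Definition scanned (z : int) : {ffun 'I_k.+2 -> symbol G} :=
  [ffun i => cells (init M' x y) i z].

Lemma scanned0 z : scanned z tape0 = word_tape M x z.
Proof. by rewrite ffunE. Qed.

Lemma scanned1 z : scanned z tape1 = word_tape M y z.
Proof. by rewrite ffunE. Qed.

Lemma forced_keep_move n q q' z m c :
    sorted_delta q (scanned z) = finset.set1 (keep_move q' (scanned z) m) ->
    forced n (parallel q' (z + offset m)) c ->
  forced n.+1 (parallel q z) c.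
Proof.
move=> mq F; apply: (@forcedS M' _ (keep_move q' (scanned z) m)) => //.
suff -> : act (keep_move q' (scanned z) m
             : action (state M') (aux M') (work_tapes M').+2)
    (parallel q z) = parallel q' (z + offset m) by [].
rewrite /parallel /=; congr Config.
  by apply: funext => i; rewrite !ffunE.
apply: funext => i; apply: funext => z'; rewrite !ffunE /=.
by case: eqP => // ->.
Qed.

(** Cells [0] to [n - 1] of the first tape hold letters, so the first blank met is at [-1], after
    [n] moves to the left; one move to the right then leads to [0]. *)
Lemma forced_return b n : (n <= size x)%N ->
  forced n.+1 (parallel (returning b) (n%:Z - 1))
    (parallel (simulating b (start M)) 0).
Proof.
elim: n => [_|n IH lt_nx].
  apply: (@forced_keep_move _ _ (simulating b (start M)) _ MoveR).
    by rewrite /= scanned0.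
  exact: forced0.
have -> : n.+1%:Z - 1 = n%:Z by rewrite intS addrAC subrr add0r.
apply: (@forced_keep_move _ _ (returning b) _ MoveL); last exact/IH/ltnW.
by rewrite /= scanned0 /=; move: lt_nx; rewrite -onthTE; case: onth.
Qed.

Lemma forced_verdict b (n : nat) :
    verdict (word_tape M x n) (word_tape M y n) = Some b -> (n <= size x)%N ->
  forced n.+2 (parallel scanning n) (parallel (simulating b (start M)) 0).
Proof.
move=> vb nx; apply: (@forced_keep_move _ _ (returning b) _ MoveL).
  by rewrite /= scanned0 scanned1 vb.
exact: forced_return.
Qed.

Lemma word_tape_cat u v : word_tape M (u ++ v) (size u) = omap inl (ohead v).
Proof. by rewrite /= onth_cat ltnn subnn; case: v. Qed.

(** Induction on the unread part [x'], with [u] the common prefix already read. A verdict after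
    [j <= size x'] more letters costs [j] moves to reach, then [size u + j + 2] for the turn and the
    return. *)
Lemma forced_scan u x' y' : x = u ++ x' -> y = u ++ y' ->
  exists2 n, (n <= (size x').*2 + size u + 2)%N &
    forced n (parallel scanning (size u))
      (parallel (simulating (~~ (x' <= y' :> seqlexi bool)%O) (start M)) 0).
Proof.
elim: x' y' u => [|a x' IH] y' u xE yE.
  exists (size u).+2; first by rewrite addn2.
  rewrite lexi0s; apply: forced_verdict; last by rewrite xE size_cat leq_addr.
  by rewrite xE yE !word_tape_cat.
have ux : (size u <= size x)%N by rewrite xE size_cat leq_addr.
have xu : word_tape M x (size u) = Some (inl a) by rewrite xE word_tape_cat.
have yu : word_tape M y (size u) = omap inl (ohead y').
  by rewrite yE word_tape_cat.
have stop b : verdict (Some (inl a)) (omap inl (ohead y')) = Some b ->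
  exists2 n, (n <= (size (a :: x')).*2 + size u + 2)%N &
    forced n (parallel scanning (size u)) (parallel (simulating b (start M)) 0).
  move=> vb; exists (size u).+2; first by rewrite addn2 !ltnS leq_addl.
  by apply: forced_verdict; rewrite // xu yu.
case: y' yE yu stop => [_ _|b y' yE yu] stop; first by rewrite lexis0; exact: stop.
rewrite lexi_cons; have [ab|ab] := eqVneq a b; last first.
  (* Distinct letters settle the lexicographic comparison. *)
  have -> : ~~ ((a <= b)%O && ((b <= a)%O ==> (x' <= y' :> seqlexi bool)%O)) = a && ~~ b.
    by move: a b ab {xE yE xu yu stop} => [] [].
  by apply: stop; rewrite /= (negbTE ab).
rewrite -ab lexx /=.
have [n le_n F] : exists2 n, (n <= (size x').*2 + size (rcons u a) + 2)%N &
    forced n (parallel scanning (size (rcons u a)))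
      (parallel (simulating (~~ (x' <= y' :> seqlexi bool)%O) (start M)) 0).
  by apply: IH; rewrite cat_rcons // ab.
exists n.+1.
  by rewrite /= doubleS !addSn ltnS (leq_trans le_n) // size_rcons (addnS _ (size u)).
apply: (@forced_keep_move _ _ scanning _ MoveR).
  by rewrite /sorted_delta scanned0 scanned1 xu yu /= ab eqxx.
by move: F; rewrite size_rcons -addn1 PoszD.
Qed.

(** The preparation has left the tapes and the output as they were, so only the labelling of the
    input tapes distinguishes this from a start of [M]. *)
Lemma parallel_simulating b :
  parallel (simulating b (start M)) 0 =
  swap_config b (init M (if b then y else x) (if b then x else y)).
Proof.
rewrite /parallel /swap_config /=; congr Config; apply: funext => i /=.
have [-> | i0] := eqVneq i tape0.
  by case: b; rewrite //= tpermL.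
have [-> | i1] := eqVneq i tape1.
  by case: b; rewrite //= tpermR.
have -> : swap_tapes b i = i.
  by case: b => //=; rewrite tpermD // eq_sym.
by case: i i0 i1 => -[|[|i]] lt_i.
Qed.

Lemma forced_init : exists b, exists2 n, (n <= (size x).*2 + 2)%N &
  forced n (init M' x y) (swap_config b (init M (lexmin x y) (lexmax x y))).
Proof.
have [n le_n F] := @forced_scan [::] x y erefl erefl.
exists (~~ (x <= y :> seqlexi bool)%O); exists n; first by rewrite addn0 in le_n.
by move: F; rewrite parallel_simulating /lexmin /lexmax minEle maxEle !if_neg.
Qed.

Lemma outputs_sorted : outputs M' x y = outputs M (lexmin x y) (lexmax x y).
Proof.
have [b [n _ F]] := forced_init.
rewrite predeqE => w; split=> [[m [c [r acc_c <-]]]|[m [c [r acc_c <-]]]].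
  have [[_ []]|[l _ /run_swap [c' r' c_eq]]] := run_forced F r.
    by case: acc_c.
  exists l, c'; split=> //; last by rewrite c_eq.
  by apply/(accepting_swap b); rewrite -c_eq.
exists (n + m)%N, (swap_config b c); split=> //; last exact/accepting_swap.
by apply: forced_run F _; apply/run_swap; exists c.
Qed.

End Preparation.

Lemma sorted_polytime : polytime M -> polytime M'.
Proof.
(* The added terms bound the preparation; the argument of [p] is unchanged since sorting preserves
   the total length. *)
move=> [p Hp]; exists (p + ('X + 'X) + 2%:P) => x y m c r.
have sizeE : size (lexmin x y) + size (lexmax x y) = size x + size y.
  by rewrite /lexmin /lexmax minEle maxEle; case: ifP; rewrite // addrC.
have -> : (p + ('X + 'X) + 2%:P).[size x + size y]
    = (p.[size x + size y] + ((size x + size y).*2 + 2))%N.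
  by rewrite !hornerD hornerX hornerC -addnn -addrA.
have [b [n le_n F]] := forced_init x y.
have {}le_n : (n <= (size x + size y).*2 + 2)%N.
  by rewrite (leq_trans le_n) // leq_add2r leq_double leq_addr.
have [[/ltnW lt_mn _]|[l -> /run_swap [c' /Hp]]] := run_forced F r.
  exact/(leq_trans lt_mn)/(leq_trans le_n)/leq_addl.
by move=> + _; rewrite sizeE => le_l; rewrite addnC leq_add.
Qed.

End SortedTransducer.

(** * Closure of the function classes and equality of the selector classes *)

Lemma FPt_lex_sorted f : FPt f -> FPt (lex_sorted f).
Proof.
move=> [M [detM polyM fM]]; exists (sorted_transducer M); split.
- exact: sorted_deterministic.
- exact: sorted_polytime.
- by move=> x y; rewrite outputs_sorted fM.
Qed.

Lemma NPSVt_lex_sorted f : NPSVt f -> NPSVt (lex_sorted f).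
Proof.
move=> [M [polyM fM]]; exists (sorted_transducer M); split.
  exact: sorted_polytime.
by move=> x y; rewrite outputs_sorted fM.
Qed.

Lemma A_selE F : (forall f, F f -> F (lex_sorted f)) -> A_sel F = CA_sel F.
Proof.
move=> F_sorted; rewrite predeqE => B; split=> [[f [Ff f_sel] fA]|[f fB [_ fA]]].
  have f_xy x y : f x y = x \/ f x y = y by have [] := f_sel x y.
  exists (lex_sorted f); last first.
    split; first exact: (@sorted_opC _ (seqlexi bool)).
    exact: (@sorted_opA _ (seqlexi bool)).
  split=> [|x y]; first exact: F_sorted.
  split; first exact: (@sorted_op_sel _ (seqlexi bool)).
  (* The condition on [B] is symmetric in the two words, so it survives their exchange. *)
  move=> Bxy; rewrite /lex_sorted /sorted_op minEle maxEle.
  by case: ifP => _; apply: (f_sel _ _).2; case: Bxy; auto.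
by exists f.
Qed.

Theorem theorem4p1 : A_P_sel = CA_P_sel /\ A_NP_sel = CA_NP_sel.
Proof.
by split; apply: A_selE => f; [exact: FPt_lex_sorted|exact: NPSVt_lex_sorted].
Qed.
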